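(* Let $J\subseteq\mathbb R$ be an interval and $\Gamma:J\to\operatorname{Spin}_{n+1}$ a smooth locally convex curve. Consider $t_0\in J$ and $\sigma\in S_{n+1}$. For $1\le j\le n$ let $m_j(t)$ be the determinant of the southwest $j\times j$ block of $\Pi(\Gamma(t))$. Then $\Gamma(t_0)\in\operatorname{Bru}_{\eta\sigma}$ if and only if, for all $j\in\{1,\ldots,n\}$, $t=t_0$ is a zero of $m_j(t)$ of multiplicity $\operatorname{mult}_j(\sigma)$.
   Context: Fix an integer $n\ge2$. $S_{n+1}$ is the group of permutations of $\{1,\ldots,n+1\}$ acting on the right, $(\sigma,k)\mapsto k^\sigma$, so $k^{\sigma_1\sigma_2}=(k^{\sigma_1})^{\sigma_2}$. $\eta\in S_{n+1}$ is the permutation $j^\eta=n+2-j$. For $1\le j\le n$, $\operatorname{mult}_j(\sigma)=(1^\sigma+\cdots+j^\sigma)-(1+\cdots+j)$. $\Pi:\operatorname{Spin}_{n+1}\to\operatorname{SO}_{n+1}$ is the universal (double) covering homomorphism; the Lie algebra of $\operatorname{Spin}_{n+1}$ is identified with $\mathfrak{so}_{n+1}$ via $\Pi$. $\mathfrak a_j\in\mathfrak{so}_{n+1}$ ($1\le j\le n$) has nonzero entries only $(\mathfrak a_j)_{j+1,j}=1$, $(\mathfrak a_j)_{j,j+1}=-1$. For $\rho\in S_{n+1}$, the unsigned Bruhat cell $\operatorname{Bru}_\rho\subset\operatorname{Spin}_{n+1}$ is the set of $z\in\operatorname{Spin}_{n+1}$ such that $\Pi(z)=U_1PU_2$ for some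 invertible real upper triangular matrices $U_1,U_2$ and some signed permutation matrix $P$ with $e_j^\top P=\pm e_{j^\rho}^\top$ for all $j$. A map $\Gamma:J\to\operatorname{Spin}_{n+1}$ is a locally convex curve if it is absolutely continuous and, wherever its derivative is defined, $(\Gamma(t))^{-1}\Gamma'(t)=\sum_{j=1}^n\kappa_j(t)\mathfrak a_j$ with $\kappa_j(t)>0$ for all $j$. The southwest $j\times j$ block of an $(n+1)\times(n+1)$ matrix consists of rows $n-j+2,\ldots,n+1$ and columns $1,\ldots,j$. ''$t_0$ is a zero of $m$ of multiplicity $\mu$'' means that $(t-t_0)^{-\mu}m(t)$ is continuous and nonzero at $t=t_0$ (after continuous extension); a zero of multiplicity $0$ is a point $t_0$ with $m(t_0)\ne0$. *)

(* Defs.v *)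
From HB Require Import structures.
From mathcomp Require Import all_boot all_order all_algebra all_fingroup all_field.
From mathcomp Require Import reals ring.

Set Implicit Arguments.
Unset Strict Implicit.
Unset Printing Implicit Defensive.

Import Order.TTheory GRing.Theory Num.Theory.

Local Open Scope ring_scope.

(** * The Clifford algebra of K^N and the spin group *)

(* The Clifford algebra with e_i ^ 2 = -1 and e_i e_j = - e_j e_i for i != j.
   An element is stored by its coordinates in the basis e_A, where e_A is the
   product of the e_i for i in A, in increasing order of i. *)
Definition clifford (K : fieldType) (N : nat) := {ffun {set 'I_N} -> K^o}.

Definition clcoef (K : fieldType) (N : nat) (x : clifford K N)
  (A : {set 'I_N}) : K := (x : {ffun {set 'I_N} -> K^o}) A.

Definition symdiff (T : finType) (A B : {set T}) : {set T} :=
  [set x | (x \in A) (+) (x \in B)].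

(* e_A e_B = clsign A B *: e_(symdiff A B): one sign for each pair (a, b) with
   b < a, to be swapped, and one for each a = b, as e_a ^ 2 = -1. *)
Definition clsign (K : fieldType) (N : nat) (A B : {set 'I_N}) : K :=
  \prod_(a in A) \prod_(b in B) (if (b <= a)%N then -1 else 1).

Definition clmul (K : fieldType) (N : nat) (x y : clifford K N) :
  clifford K N :=
  [ffun C => \sum_A clsign K A (symdiff A C) * clcoef x A
                      * clcoef y (symdiff A C)].

Definition clbasis (K : fieldType) (N : nat) (A : {set 'I_N}) :
  clifford K N := [ffun B => (B == A)%:R].

HB.instance Definition _ (K : fieldType) (N : nat) :=
  Vector.copy (clifford K N) {ffun {set 'I_N} -> K^o}.

Section CliffordRing.
Variables (K : fieldType) (N : nat).
Implicit Types (A B C : {set 'I_N}) (x y z : clifford K N).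

Lemma clifford_eqP x y : (forall A, clcoef x A = clcoef y A) -> x = y.
Proof. by move=> xy; apply/ffunP => A; exact: xy. Qed.

Lemma clcoefD x y A : clcoef (x + y) A = clcoef x A + clcoef y A.
Proof. by rewrite /clcoef ffunE. Qed.

Lemma clcoefZ a x A : clcoef (a *: x) A = a * clcoef x A.
Proof. by rewrite /clcoef ffunE. Qed.

Lemma clcoefM x y C : clcoef (clmul x y) C =
  \sum_A clsign K A (symdiff A C) * clcoef x A * clcoef y (symdiff A C).
Proof. by rewrite /clcoef ffunE. Qed.

Lemma clcoefB A B : clcoef (clbasis K A) B = (B == A)%:R.
Proof. by rewrite /clcoef ffunE. Qed.

Lemma symdiffA A B C : symdiff A (symdiff B C) = symdiff (symdiff A B) C.
Proof. by apply/setP => i; rewrite !inE addbA. Qed.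

Lemma symdiffC A B : symdiff A B = symdiff B A.
Proof. by apply/setP => i; rewrite !inE addbC. Qed.

Lemma symdiffv A : symdiff A A = set0.
Proof. by apply/setP => i; rewrite !inE addbb. Qed.

Lemma symdiff0 A : symdiff A set0 = A.
Proof. by apply/setP => i; rewrite !inE addbF. Qed.

Lemma symdiff0l A : symdiff set0 A = A.
Proof. by rewrite symdiffC symdiff0. Qed.

Lemma symdiffK A B : symdiff A (symdiff A B) = B.
Proof. by rewrite symdiffA symdiffv symdiff0l. Qed.

Lemma symdiffK_eq A B C : (symdiff A B == C) = (B == symdiff A C).
Proof. by apply/eqP/eqP => [<-|->]; rewrite symdiffK. Qed.

Lemma prod_symdiff (f : 'I_N -> K) A B : (forall i, f i * f i = 1) ->
  \prod_(i in symdiff A B) f i = (\prod_(i in A) f i) * \prod_(i in B) f i.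
Proof.
move=> ff; rewrite !(big_mkcond (fun i => i \in _)) -big_split /=.
apply: eq_bigr => i _; rewrite inE.
by case: (i \in A) (i \in B) => [] [] /=; rewrite ?mulr1 ?mul1r ?ff.
Qed.

Lemma clsignDl A B C :
  clsign K (symdiff A B) C = clsign K A C * clsign K B C.
Proof.
rewrite /clsign prod_symdiff // => i; rewrite -big_split big1 //= => j _.
by case: ifP; rewrite ?mulrNN mulr1.
Qed.

Lemma clsignDr A B C :
  clsign K A (symdiff B C) = clsign K A B * clsign K A C.
Proof.
rewrite /clsign -big_split; apply: eq_bigr => a _ /=.
by rewrite prod_symdiff // => i; case: ifP; rewrite ?mulrNN mulr1.
Qed.

Lemma clmulA : associative (@clmul K N).
Proof.
move=> x y z; apply: clifford_eqP => D; rewrite !clcoefM.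
pose F A B := clsign K A B * clsign K (symdiff A B) (symdiff (symdiff A B) D)
  * clcoef x A * clcoef y B * clcoef z (symdiff (symdiff A B) D).
transitivity (\sum_A \sum_B F A B).
  apply: eq_bigr => A _; rewrite clcoefM mulr_sumr; apply: eq_bigr => B _.
  rewrite /F symdiffA (symdiffC B A).
  have -> : symdiff A D = symdiff B (symdiff (symdiff A B) D).
    by rewrite !symdiffA (symdiffC B A) -(symdiffA A) symdiffv symdiff0.
  by rewrite clsignDl clsignDr; ring.
under [RHS]eq_bigr do rewrite clcoefM mulr_sumr mulr_suml.
rewrite [RHS]exchange_big /=; apply: eq_bigr => A _.
rewrite (reindex_inj (can_inj (symdiffK A))); apply: eq_bigr => C _.
by rewrite /F symdiffK; ring.
Qed.

Lemma clsign0l A : clsign K set0 A = 1.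
Proof. by rewrite /clsign big_set0. Qed.

Lemma clsign0r A : clsign K A set0 = 1.
Proof. by rewrite /clsign big1 // => i _; rewrite big_set0. Qed.

Lemma clmul1x : left_id (clbasis K set0) (@clmul K N).
Proof.
move=> x; apply: clifford_eqP => A; rewrite clcoefM (bigD1 set0) //=.
rewrite big1 => [|B /negPf nB]; last by rewrite clcoefB nB mulr0 mul0r.
by rewrite clcoefB eqxx clsign0l symdiff0l !mul1r addr0.
Qed.

Lemma clmulx1 : right_id (clbasis K set0) (@clmul K N).
Proof.
move=> x; apply: clifford_eqP => A; rewrite clcoefM (bigD1 A) //=.
rewrite big1 => [|B /negPf nB]; last first.
  by rewrite clcoefB symdiffK_eq symdiff0 eq_sym nB mulr0.
by rewrite clcoefB symdiffv eqxx clsign0r mul1r mulr1 addr0.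
Qed.

Lemma clmulDl : left_distributive (@clmul K N) +%R.
Proof.
move=> x y z; apply: clifford_eqP => A; rewrite clcoefD !clcoefM -big_split.
by apply: eq_bigr => B _; rewrite clcoefD /= mulrDr mulrDl.
Qed.

Lemma clmulDr : right_distributive (@clmul K N) +%R.
Proof.
move=> x y z; apply: clifford_eqP => A; rewrite clcoefD !clcoefM -big_split.
by apply: eq_bigr => B _; rewrite clcoefD /= mulrDr.
Qed.

Lemma clbasis0_neq0 : clbasis K set0 != 0 :> clifford K N.
Proof.
apply/eqP => /(congr1 (fun x : clifford K N => clcoef x set0)).
by rewrite clcoefB eqxx /clcoef ffunE; apply/eqP; rewrite oner_neq0.
Qed.

HB.instance Definition _ := GRing.Zmodule_isNzRing.Build (clifford K N)
  clmulA clmul1x clmulx1 clmulDl clmulDr clbasis0_neq0.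

Lemma clscaleAl (a : K) x y : a *: (x * y) = (a *: x) * y.
Proof.
apply: clifford_eqP => A; rewrite clcoefZ !clcoefM mulr_sumr.
by apply: eq_bigr => B _; rewrite clcoefZ; ring.
Qed.

HB.instance Definition _ := GRing.Lmodule_isLalgebra.Build K (clifford K N)
  clscaleAl.

Lemma clscaleAr (a : K) x y : a *: (x * y) = x * (a *: y).
Proof.
apply: clifford_eqP => A; rewrite clcoefZ !clcoefM mulr_sumr.
by apply: eq_bigr => B _; rewrite clcoefZ; ring.
Qed.

HB.instance Definition _ := GRing.Lalgebra_isAlgebra.Build K (clifford K N)
  clscaleAr.

HB.instance Definition _ := Algebra_isFalgebra.Build K (clifford K N).

End CliffordRing.

Definition clgen (K : fieldType) (N : nat) (i : 'I_N) : clifford K N :=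
  clbasis K [set i].

Lemma clbasisM (K : fieldType) (N : nat) (A B : {set 'I_N}) :
  clbasis K A * clbasis K B = clsign K A B *: clbasis K (symdiff A B).
Proof.
apply: clifford_eqP => C; rewrite clcoefZ clcoefM (bigD1 A) //= big1.
  rewrite !clcoefB eqxx symdiffK_eq mulr1 addr0.
  by case: eqP => [->|_]; rewrite ?symdiffK // !mulr0.
by move=> D /negPf nD; rewrite clcoefB nD mulr0 mul0r.
Qed.

Lemma clgenM (K : fieldType) (N : nat) (i j : 'I_N) :
  clgen K i * clgen K j + clgen K j * clgen K i = (- (i == j)%:R *+ 2)%:A.
Proof.
rewrite !clbasisM /clsign !big_set1 symdiffC -scalerDl.
case: eqVneq => [->|nij].
  by rewrite symdiffv leqnn mulr2n.
rewrite oppr0 mul0rn scale0r; case: (ltnP i j) => [ij|ji].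
  by rewrite (ltnW ij) subrr scale0r.
by rewrite leqNgt ltn_neqAle eq_sym (inj_eq val_inj) nij ji addNr scale0r.
Qed.

Definition clvec (K : fieldType) (N : nat) (v : 'rV[K]_N) : clifford K N :=
  \sum_i v 0 i *: clgen K i.

Definition is_unit_vector (R : realType) (N : nat) (v : 'rV[R]_N) : Prop :=
  \sum_i v 0 i ^+ 2 = 1.

(* Spin_N: the products of an even number of unit vectors of R^N. *)
Definition spin (R : realType) (N : nat) (z : clifford R N) : Prop :=
  exists s : seq 'rV[R]_N,
    [/\ forall v, v \in s -> is_unit_vector v, ~~ odd (size s)
      & z = \prod_(v <- s) clvec v].

(* The matrix of the rotation v |-> z v z^-1 of R^N, acting on columns. *)
Definition spin_cover (R : realType) (N : nat) (z : clifford R N) : 'M[R]_N :=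
  \matrix_(i, j) clcoef (z * clgen R j * z^-1) [set i].

(* The differential of spin_cover at 1, namely x |-> (v |-> x v - v x). It maps
   the Lie algebra of Spin_N, the span of the e_i e_j with i < j, isomorphically
   onto so_N. *)
Definition dspin_cover (R : realType) (N : nat) (x : clifford R N) : 'M[R]_N :=
  \matrix_(i, j) clcoef (x * clgen R j - clgen R j * x) [set i].

(* Below, N = n.+1 and the indices 1, ..., n + 1 become 0, ..., n. *)

Definition amx (R : realType) (n : nat) (j : 'I_n) : 'M[R]_n.+1 :=
  delta_mx (lift ord0 j) (widen_ord (leqnSn n) j)
  - delta_mx (widen_ord (leqnSn n) j) (lift ord0 j).

(** * Permutations and Bruhat cells *)

(* In 'S_n.+1, (s * t) k = t (s k): the product is that of right actions. *)
Definition eta_perm (n : nat) : 'S_n.+1 := perm (@rev_ord_inj n.+1).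

(* Shifting indices from 1 .. n + 1 to 0 .. n does not change the difference;
   the subtraction in nat is exact, as s is injective. *)
Definition mult_perm (n : nat) (s : 'S_n.+1) (j : nat) : nat :=
  (\sum_(i < n.+1 | (i < j)%N) s i - \sum_(i < n.+1 | (i < j)%N) i)%N.

Definition upper_triangular (R : realType) (N : nat) (U : 'M[R]_N) : Prop :=
  forall i j : 'I_N, (j < i)%N -> U i j = 0.

Definition is_signed_perm_mx (R : realType) (N : nat) (r : 'S_N)
  (P : 'M[R]_N) : Prop :=
  exists e : 'I_N -> bool, forall i j, P i j = (-1) ^+ e i * (j == r i)%:R.

Definition bruhat_cell (R : realType) (n : nat) (r : 'S_n.+1)
  (z : clifford R n.+1) : Prop :=
  spin z /\
  exists U1 P U2 : 'M[R]_n.+1,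
    [/\ upper_triangular U1 /\ U1 \in unitmx,
        is_signed_perm_mx r P,
        upper_triangular U2 /\ U2 \in unitmx
      & spin_cover z = U1 *m P *m U2].

(* Meaningful for j <= n.+1, when both inord are exact. *)
Definition southwest (R : realType) (n j : nat) (Q : 'M[R]_n.+1) : 'M[R]_j :=
  \matrix_(a < j, b < j) Q (inord (n.+1 - j + a)) (inord b).

(** * Curves on an interval *)

From mathcomp Require Import all_classical all_reals all_analysis.
Import numFieldNormedType.Exports.

Local Open Scope classical_set_scope.

(* Derivatives are taken within J, hence are one-sided at the endpoints of J
   that belong to J. *)
Definition has_derivative_in (R : realType) (J : set R) (f : R -> R)
  (t l : R) : Prop :=
  (fun s => (s - t)^-1 * (f s - f t)) @ within J t^' --> l.

Definition smooth_on (R : realType) (J : set R) (f : R -> R) : Prop :=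
  exists D : nat -> R -> R,
    (forall t, J t -> D 0%N t = f t) /\
    (forall k t, J t -> has_derivative_in J (D k) t (D k.+1 t)).

Definition abs_continuous_on (R : realType) (J : set R) (f : R -> R) : Prop :=
  forall a b, J a -> J b -> a <= b ->
  forall eps, 0 < eps -> exists2 delta, 0 < delta &
    forall s : seq (R * R),
      (forall p, p \in s -> [/\ a <= p.1, p.1 <= p.2 & p.2 <= b]) ->
      pairwise (fun p q => p.2 <= q.1) s ->
      \sum_(p <- s) (p.2 - p.1) < delta ->
      \sum_(p <- s) `|f p.2 - f p.1| < eps.

(* A curve J -> Spin_N is given by a total function, only used on J. *)
Definition spin_curve (R : realType) (N : nat) (J : set R)
  (G : R -> clifford R N) : Prop := forall t, J t -> spin (G t).

Definition smooth_curve (R : realType) (N : nat) (J : set R)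
  (G : R -> clifford R N) : Prop :=
  forall A, smooth_on J (fun t => clcoef (G t) A).

Definition curve_derivative (R : realType) (N : nat) (J : set R)
  (G : R -> clifford R N) (t : R) (v : clifford R N) : Prop :=
  forall A, has_derivative_in J (fun s => clcoef (G s) A) t (clcoef v A).

(* G^-1 G' lies in the Lie algebra of Spin_{n+1}, which dspin_cover identifies
   with so_{n+1}. *)
Definition locally_convex_curve (R : realType) (n : nat) (J : set R)
  (G : R -> clifford R n.+1) : Prop :=
  [/\ spin_curve J G,
      forall A, abs_continuous_on J (fun t => clcoef (G t) A)
    & exists kappa : 'I_n -> R -> R, forall t v,
        J t -> curve_derivative J G t v ->
        (forall j, 0 < kappa j t) /\
        dspin_cover ((G t)^-1 * v) = \sum_j kappa j t *: amx R j].

Definition zero_of_multiplicity (R : realType) (J : set R) (m : R -> R)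
  (t0 : R) (mu : nat) : Prop :=
  if mu is 0%N then m t0 != 0
  else exists2 l, l != 0 &
    (fun t => (t - t0) ^- mu * m t) @ within J t0^' --> l.

(* Main.v *)
Require Import Defs.
From mathcomp Require Import all_boot all_order all_algebra all_fingroup all_field.
From mathcomp Require Import all_classical all_reals all_analysis.
From mathcomp Require Import ring lra zify.

Set Implicit Arguments.
Unset Strict Implicit.
Unset Printing Implicit Defensive.

Import Order.TTheory GRing.Theory Num.Theory.
Import numFieldNormedType.Exports.

(** Write [Q t] for the rotation matrix of [Gamma t] and [A t] for the
    tridiagonal matrix of [(Gamma t)^-1 * Gamma' t], so that [Q' = Q A]
    (spin_cover_derivative). If [Q t0 = U1 P U2] with [P] a signed permutation
    matrix for [eta * sigma], put [M t = U1^-1 Q t]. Then [M' = M A] still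
    holds, and since [U1] is upper triangular the southwest minors of [M] are
    constant nonzero multiples of those of [Q] (det_southwest_mul). At [t0] each
    row of [M] is, up to sign, a row of [U2]: its first nonzero entry sits in a
    column [r], which for the bottom [j] rows runs over the first [j] values of
    [sigma].

    The entries [f k] of a row of [M] satisfy
    [f k' = kappa k * f k.+1 - kappa k.-1 * f k.-1]. Going down from the column
    [r], each step to the left costs one integration, and the neighbour on the
    left is of higher order, so by L'Hopital's rule [f k] is equivalent to a
    constant times [(t - t0) ^+ (r - k) / (r - k)!] (tridiagonal_growth). Hence
    the southwest minor, multiplied by the power of [t - t0] whose exponent is
    the sum of the columns minus the sum of the [r], converges to a
    determinant. Up to nonzero factors on the rows and columns this is the
    determinant of the falling factorials [r a ^_ k], which is nonzero for
    distinct [r a] by a Vandermonde argument (det_ffact_neq0). So the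
    multiplicity is exactly [mult_perm sigma j] (southwest_det_growth).

    Conversely, Gaussian elimination puts [Gamma t0] in some cell
    (spin_bruhat_cell); the multiplicities determine the permutation of that
    cell (mult_perm_inj), because they determine its partial sums. *)

Local Open Scope ring_scope.

(** * Derivatives within an interval *)

Local Open Scope classical_set_scope.

Lemma near_within_dnbhsP (R : realType) (J : set R) (t : R) (P : R -> Prop) :
  (\forall s \near within J t^', P s) <->
  exists2 e, 0 < e & forall s, J s -> s != t -> `|s - t| < e -> P s.
Proof.
split.
  case/nbhs_ballP => e e0 Pe; exists e => // s Js st se.
  by apply: Pe => //; rewrite /ball /= distrC.
case=> e e0 Pe; apply/nbhs_ballP; exists e => // s se st Js.
by apply: Pe => //; rewrite distrC.
Qed.

Lemma within_dnbhs_proper (R : realType) (J : set R) (t : R) :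
  is_interval J -> (exists a b, [/\ J a, J b & a < b]) -> J t ->
  ProperFilter (within J t^').
Proof.
move=> iJ [a [b [Ja Jb ab]]] Jt.
have [c Jc ct] : exists2 c, J c & c != t.
  have [ta|] := eqVneq a t; last by exists a.
  by exists b => //; rewrite -ta gt_eqF.
apply: Build_ProperFilter_ex => P /near_within_dnbhsP [e e0 Pe].
have d0 : 0 < `|c - t| by rewrite normr_gt0 subr_eq0.
(* A point between [t] and [c], at distance at most [e / 2] from [t]. *)
pose l := Num.min 1 (e / 2 / `|c - t|).
have l0 : 0 < l by rewrite lt_min ltr01 !divr_gt0.
have l1 : l <= 1 by rewrite ge_min lexx.
exists (t + l * (c - t)); apply: Pe.
- case: (ltgtP c t) ct => // ct _.
    by apply: (iJ c t) => //; apply/andP; split; nra.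
  by apply: (iJ t c) => //; apply/andP; split; nra.
- by rewrite addrC -subr_eq0 addrK mulf_neq0 ?subr_eq0 // gt_eqF.
- rewrite addrAC subrr add0r normrM gtr0_norm //.
  apply: (@le_lt_trans _ _ (e / 2)).
    by rewrite -ler_pdivlMr // ge_min lexx orbT.
  by rewrite ltr_pdivrMr // ltr_pMr // ltr1n.
Qed.

Lemma cvg_sub_base (R : realType) (J : set R) (t : R) :
  (fun s => s - t) @ within J t^' --> (0 : R).
Proof.
apply/cvgr0Pnorm_lt => e e0.
by apply/near_within_dnbhsP; exists e.
Qed.

Lemma near_within_neq (R : realType) (J : set R) (t : R) :
  \forall s \near within J t^', J s /\ s - t != 0.
Proof.
by apply/near_within_dnbhsP; exists 1 => // s Js st _; rewrite subr_eq0.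
Qed.

Lemma cvg_near_ext (R : realType) (F : set_system R) {FF : Filter F}
    (f g : R -> R) (l l' : R) :
  (\forall s \near F, f s = g s) -> l = l' -> f @ F --> l -> g @ F --> l'.
Proof. by move=> fg <-; apply: cvg_trans; exact: near_eq_cvg. Qed.

Lemma has_derivative_in_continuous (R : realType) (J : set R) (f : R -> R)
    (t l : R) :
  has_derivative_in J f t l -> f @ within J t^' --> f t.
Proof.
move=> fl.
refine (cvg_near_ext _ _
  (cvgD (cvgM (@cvg_sub_base R J t) fl) (cvg_cst (f t)))); last first.
  by rewrite mul0r add0r.
near=> s.
change ((s - t) * ((s - t)^-1 * (f s - f t)) + f t = f s).
rewrite mulrA divff ?mul1r ?subrK //.
by near: s; apply: filterS (near_within_neq J t) => s [].
Unshelve. all: end_near. Qed.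

Lemma has_derivative_in_ext (R : realType) (J : set R) (f g : R -> R)
    (t l l' : R) : J t -> (forall s, J s -> f s = g s) -> l = l' ->
  has_derivative_in J f t l -> has_derivative_in J g t l'.
Proof.
move=> Jt fg ll H; refine (cvg_near_ext _ ll H) => {H}; near=> s.
by rewrite !fg //; near: s; apply: filterS (near_within_neq J t) => s [].
Unshelve. all: end_near. Qed.

Lemma has_derivative_in_cst (R : realType) (J : set R) (c t : R) :
  has_derivative_in J (fun=> c) t 0.
Proof.
rewrite /has_derivative_in; under eq_fun do rewrite subrr mulr0.
exact: cvg_cst.
Qed.

Lemma has_derivative_inM (R : realType) (J : set R) (f g : R -> R)
    (t a b : R) :
  has_derivative_in J f t a -> has_derivative_in J g t b ->
  has_derivative_in J (fun s => f s * g s) t (a * g t + f t * b).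
Proof.
move=> fa gb.
refine (cvg_near_ext _ erefl (cvgD
  (cvgM fa (has_derivative_in_continuous gb)) (cvgM (cvg_cst (f t)) gb))).
near=> s.
change ((s - t)^-1 * (f s - f t) * g s + f t * ((s - t)^-1 * (g s - g t))
  = (s - t)^-1 * (f s * g s - f t * g t)).
by ring.
Unshelve. all: end_near. Qed.

Lemma has_derivative_inD (R : realType) (J : set R) (f g : R -> R)
    (t a b : R) :
  has_derivative_in J f t a -> has_derivative_in J g t b ->
  has_derivative_in J (fun s => f s + g s) t (a + b).
Proof.
move=> fa gb; refine (cvg_near_ext _ erefl (cvgD fa gb)); near=> s.
change ((s - t)^-1 * (f s - f t) + (s - t)^-1 * (g s - g t)
  = (s - t)^-1 * (f s + g s - (f t + g t))).
by ring.
Unshelve. all: end_near. Qed.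

Lemma has_derivative_in_sum (R : realType) (J : set R) (I : finType)
    (f : I -> R -> R) (t : R) (a : I -> R) :
  (forall i, has_derivative_in J (f i) t (a i)) ->
  has_derivative_in J (fun s => \sum_i f i s) t (\sum_i a i).
Proof.
move=> fa.
refine (cvg_near_ext _ erefl
  (@cvg_big R I +%R 0 xpredT (@add_continuous _) R (within J t^')
    (index_enum I) _ a _ (fun i _ => fa i))); near=> s.
by rewrite -mulr_sumr sumrB.
Unshelve. all: end_near. Qed.

Lemma has_derivative_inZ (R : realType) (J : set R) (c : R) (f : R -> R)
    (t a : R) :
  has_derivative_in J f t a -> has_derivative_in J (fun s => c * f s) t (c * a).
Proof.
move=> fa; refine (cvg_near_ext _ erefl (cvgM (cvg_cst c) fa)); near=> s.
change (c * ((s - t)^-1 * (f s - f t)) = (s - t)^-1 * (c * f s - c * f t)).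
by ring.
Unshelve. all: end_near. Qed.

Lemma has_derivative_in_unique (R : realType) (J : set R) (f : R -> R)
    (t a b : R) : ProperFilter (within J t^') ->
  has_derivative_in J f t a -> has_derivative_in J f t b -> a = b.
Proof. by move=> ?; exact: cvg_unique. Qed.

Lemma has_derivative_in_expn (R : realType) (J : set R) (c t : R) (m : nat) :
  has_derivative_in J (fun s => (s - c) ^+ m.+1) t (m.+1%:R * (t - c) ^+ m).
Proof.
have X1 : has_derivative_in J (fun s => s - c) t 1.
  refine (@cvg_near_ext _ _ _ (fun=> 1) _ 1 _ _ erefl (cvg_cst _)).
  near=> s; rewrite opprB addrA subrK mulVf //.
  by near: s; apply: filterS (near_within_neq J t) => s [].
elim: m => [|m IHm]; first by rewrite mulr1.
under eq_fun do rewrite exprS.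
suff -> : m.+2%:R * (t - c) ^+ m.+1 =
  1 * (t - c) ^+ m.+1 + (t - c) * (m.+1%:R * (t - c) ^+ m).
  exact: (@has_derivative_inM R J (fun s => s - c) _ t _ _ X1 IHm).
by rewrite exprS -[m.+2%:R]natr1; ring.
Unshelve. all: end_near. Qed.

Lemma cvg_expn_base (R : realType) (J : set R) (t : R) (m : nat) :
  (0 < m)%N -> (fun s => (s - t) ^+ m) @ within J t^' --> (0 : R).
Proof.
case: m => // m _.
have := @has_derivative_in_continuous R J _ t _
  (@has_derivative_in_expn R J t t m).
by rewrite subrr expr0n.
Qed.

(** In the open interval between [a] and [b], derivatives within [J] are
    ordinary derivatives. *)
Lemma MVT_in (R : realType) (J : set R) (f df : R -> R) (a b : R) :
  is_interval J -> J a -> J b -> a < b ->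
  (forall x, J x -> has_derivative_in J f x (df x)) ->
  exists2 c, a < c < b & f b - f a = df c * (b - a).
Proof.
move=> iJ Ja Jb ab fdf.
have Jab x : a <= x <= b -> J x by apply: iJ.
have [x||c cab fc] := @MVT R f df a b ab.
- rewrite in_itv /= => /andP[ax xb].
  apply/is_derive1_caratheodory.
  exists (fun z => if z == x then df x else (z - x)^-1 * (f z - f x)).
  split=> [z||]; rewrite ?eqxx //.
    case: eqP => [->|/eqP zx]; first by rewrite !subrr mulr0.
    by rewrite mulrAC mulVf ?mul1r // subr_eq0.
  apply/continuous_withinNx; rewrite eqxx.
  apply/cvgrPdist_lt => e e0.
  have Jx : J x by apply: Jab; rewrite !ltW.
  move: (fdf x Jx); rewrite /has_derivative_in => /cvgrPdist_lt /(_ e e0).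
  move=> /near_within_dnbhsP [d d0 fd].
  have -> : x^' = within setT x^' by rewrite withinET.
  apply/near_within_dnbhsP; exists (Num.min d (Num.min (x - a) (b - x))).
    by rewrite !lt_min d0 !subr_gt0 ax xb.
  move=> s _ sx; rewrite !lt_min (negPf sx) => /and3P[sd sa sb].
  apply: fd => //; apply: Jab.
  move: sa sb; rewrite !ltr_norml => /andP[? ?] /andP[? ?].
  by apply/andP; split; lra.
- apply/subspace_continuousP => x /=; rewrite in_itv /= => /Jab Jx.
  apply/cvgrPdist_lt => e e0.
  have /cvgrPdist_lt /(_ e e0) := has_derivative_in_continuous (fdf x Jx).
  move=> /near_within_dnbhsP [d d0 fd]; apply/nbhs_ballP; exists d => // s.
  rewrite /ball /= distrC in_itv /= => sd /Jab Js.
  have [->|sx] := eqVneq s x; first by rewrite subrr normr0.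
  exact: fd.
- by exists c; first by move: cab; rewrite in_itv.
Qed.

(** L'Hopital's rule for powers: by the mean value theorem, subtracting from
    [g] the primitive of the leading term of its derivative leaves a remainder
    whose increments are small compared with [(t - t0) ^+ m.+1]. *)
Lemma cvg_div_expn_antiderivative (R : realType) (J : set R) (g dg : R -> R)
    (t0 l : R) (m : nat) :
  is_interval J -> J t0 -> g t0 = 0 ->
  (forall x, J x -> has_derivative_in J g x (dg x)) ->
  (fun t => (t - t0) ^- m * dg t) @ within J t0^' --> l ->
  (fun t => (t - t0) ^- m.+1 * g t) @ within J t0^' --> l / m.+1%:R.
Proof.
move=> iJ Jt0 g0 gdg lim; set c := l / m.+1%:R.
have lE : l = c * m.+1%:R by rewrite divfK // pnatr_eq0.
pose h s := g s - c * (s - t0) ^+ m.+1.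
pose dh s := dg s - l * (s - t0) ^+ m.
have hdh x : J x -> has_derivative_in J h x (dh x).
  move=> Jx; have := has_derivative_inD (gdg x Jx)
    (has_derivative_inZ (c := - c) (@has_derivative_in_expn R J t0 x m)).
  apply: has_derivative_in_ext => // [s _|]; first by rewrite mulNr.
  by rewrite /dh lE mulNr mulrA.
apply/cvgrPdist_le => e e0.
have /cvgrPdist_le /(_ e e0) /near_within_dnbhsP [d d0 le_e] := lim.
apply/near_within_dnbhsP; exists d => // s Js st0 sd.
have s0 : s - t0 != 0 by rewrite subr_eq0.
have dh_le x : J x -> x != t0 -> `|x - t0| < d ->
    `|dh x| <= e * `|x - t0| ^+ m.
  move=> Jx xt0 xd; have := le_e x Jx xt0 xd.
  have x0 : (x - t0) ^+ m != 0 by rewrite expf_neq0 // subr_eq0.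
  have -> : l - (x - t0) ^- m * dg x = - (dh x) / (x - t0) ^+ m.
    by rewrite /dh opprB mulrBl mulfK // mulrC.
  rewrite normrM normrN normfV normrX ler_pdivrMr //.
  by rewrite exprn_gt0 // normr_gt0 subr_eq0.
have h0 : h t0 = 0 by rewrite /h g0 subrr expr0n /= mulr0 subr0.
suff : `|h s| <= e * `|s - t0| ^+ m.+1.
  have -> : c - (s - t0) ^- m.+1 * g s = - h s / (s - t0) ^+ m.+1.
    by rewrite /h opprB mulrBl mulfK ?expf_neq0 // mulrC.
  by rewrite normrM normrN normfV normrX ler_pdivrMr // exprn_gt0 // normr_gt0.
have [x [Jx xt0 xs hs]] : exists x,
    [/\ J x, x != t0, `|x - t0| <= `|s - t0| & `|h s| = `|dh x| * `|s - t0|].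
  have [st|ts|/eqP] := ltgtP s t0; last by rewrite (negPf st0).
    have [x /andP[sx xt]] := MVT_in iJ Js Jt0 st hdh.
    rewrite h0 sub0r => hs; exists x; split.
    - by apply: (iJ s t0) => //; rewrite !ltW.
    - by rewrite lt_eqF.
    - by rewrite !ltr0_norm ?subr_lt0 // !opprB lerB // ltW.
    - by rewrite -normrN hs normrM (distrC s).
  have [x /andP[sx xt]] := MVT_in iJ Jt0 Js ts hdh.
  rewrite h0 subr0 => hs; exists x; split.
  - by apply: (iJ t0 s) => //; rewrite !ltW.
  - by rewrite gt_eqF.
  - by rewrite !gtr0_norm ?subr_gt0 // lerB // ltW.
  - by rewrite hs normrM.
rewrite hs exprSr mulrA ler_wpM2r //.
apply: le_trans (dh_le x Jx xt0 (le_lt_trans xs sd)) _.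
by rewrite ler_wpM2l ?(ltW e0) // lerXn2r ?nnegrE.
Qed.

(** * Growth along a tridiagonal system *)

(** The equations of the entries of a row vector transported by
    [\sum_k kap k *: amx k], indexed by all natural numbers. *)
Definition tridiagonal_flow (R : realType) (J : set R)
    (f kap : nat -> R -> R) : Prop :=
  forall k t, J t -> has_derivative_in J (f k) t
    (kap k t * f k.+1 t - (if k is k'.+1 then kap k' t * f k' t else 0)).

Lemma tridiagonal_step (R : realType) (J : set R) (t0 : R)
    (f kap : nat -> R -> R) (k m : nat) (a : R) :
  is_interval J -> J t0 -> tridiagonal_flow J f kap ->
  (forall k, kap k @ within J t0^' --> kap k t0) -> f k t0 = 0 ->
  (fun t => (t - t0) ^- m * f k.+1 t) @ within J t0^' --> a ->
  (forall k', k = k'.+1 ->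
    (fun t => (t - t0) ^- m * f k' t) @ within J t0^' --> (0 : R)) ->
  (fun t => (t - t0) ^- m.+1 * f k t) @ within J t0^' -->
    kap k t0 * a / m.+1%:R.
Proof.
move=> iJ Jt0 f_df kap_cvg fk0 up down.
refine (cvg_div_expn_antiderivative iJ Jt0 fk0 (@f_df k) _).
have down0 : (fun t => (t - t0) ^- m *
    (if k is k'.+1 then kap k' t * f k' t else 0)) @ within J t0^' --> (0 : R).
  case: k {fk0 up} down => [_|k' /(_ _ erefl) down].
    by under eq_fun do rewrite mulr0; exact: cvg_cst.
  refine (cvg_near_ext _ _ (cvgM (@kap_cvg k') down)); last by rewrite mulr0.
  by apply: nearW => t; rewrite mulrCA.
refine (cvg_near_ext _ _ (cvgB (cvgM (@kap_cvg k) up) down0)).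
  by apply: nearW => t; rewrite mulrBr mulrCA.
by rewrite subr0.
Qed.

(** Only a rough order is needed to discard the lower neighbour in the exact
    growth below; it is obtained first, by induction on the order for all
    indices at once. *)
Lemma tridiagonal_vanish (R : realType) (J : set R) (t0 : R)
    (f kap : nat -> R -> R) (r m k : nat) :
  is_interval J -> J t0 -> tridiagonal_flow J f kap ->
  (forall k, kap k @ within J t0^' --> kap k t0) ->
  (forall i, (i < r)%N -> f i t0 = 0) -> (m + k < r)%N ->
  (fun t => (t - t0) ^- m * f k t) @ within J t0^' --> (0 : R).
Proof.
move=> iJ Jt0 f_df kap_cvg f0; elim: m k => [|m IHm] k kr.
  rewrite -(f0 k kr); under eq_fun do rewrite expr0 invr1 mul1r.
  exact: has_derivative_in_continuous (f_df k t0 Jt0).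
rewrite -[X in _ --> X](_ : kap k t0 * 0 / m.+1%:R = 0); last first.
  by rewrite mulr0 mul0r.
apply: tridiagonal_step => // [||k' kE].
- by apply: f0; lia.
- by apply: IHm; lia.
- by apply: IHm; lia.
Qed.

Lemma tridiagonal_growth (R : realType) (J : set R) (t0 : R)
    (f kap : nat -> R -> R) (r d k : nat) :
  is_interval J -> J t0 -> tridiagonal_flow J f kap ->
  (forall k, kap k @ within J t0^' --> kap k t0) ->
  (forall i, (i < r)%N -> f i t0 = 0) -> (k + d)%N = r ->
  (fun t => (t - t0) ^- d * f k t) @ within J t0^' -->
    f r t0 * (\prod_(k <= i < r) kap i t0) / d`!%:R.
Proof.
move=> iJ Jt0 f_df kap_cvg f0; elim: d k => [|d IHd] k kr.
  rewrite -kr addn0 big_geq // fact0 divr1 mulr1.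
  under eq_fun do rewrite expr0 invr1 mul1r.
  exact: has_derivative_in_continuous (f_df k t0 Jt0).
have kltr : (k < r)%N by lia.
have up := IHd k.+1; rewrite addSn -addnS in up.
rewrite -[X in _ --> X](_ : kap k t0 *
  (f r t0 * (\prod_(k.+1 <= i < r) kap i t0) / d`!%:R) / d.+1%:R = _).
  apply: tridiagonal_step => // [||k' kE]; [exact: f0|exact: up|].
  by apply: (@tridiagonal_vanish R J t0 f kap r) => //; lia.
by rewrite (big_ltn kltr) factS natrM invfM; ring.
Qed.

(** * Falling factorial determinants *)

Definition ffact_poly (R : nzRingType) (k : nat) : {poly R} :=
  \prod_(i < k) ('X - i%:R%:P).

Lemma horner_ffact_poly (R : comNzRingType) (k m : nat) :
  (ffact_poly R k).[m%:R] = (m ^_ k)%:R.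
Proof.
rewrite horner_prod; elim: k => [|k IHk]; first by rewrite big_ord0 ffactn0.
rewrite big_ord_recr /= {}IHk hornerXsubC ffactnSr natrM.
have [km|mk] := leqP k m; first by rewrite natrB.
by rewrite ffact_small // !mul0r.
Qed.

Lemma size_ffact_poly (R : idomainType) (k : nat) :
  size (ffact_poly R k) = k.+1.
Proof.
rewrite /ffact_poly -(big_map (fun i : 'I_k => i%:R) xpredT
  (fun x => 'X - x%:P)) size_prod_XsubC size_map.
by rewrite -[index_enum _]enumT size_enum_ord.
Qed.

(** A combination of the columns is a polynomial of degree less than [j] in the
    row parameter, so it cannot vanish at [j] distinct parameters. *)
Lemma det_ffact_neq0 (R : numFieldType) (j : nat) (r : 'I_j -> nat) :
  injective r -> \det (\matrix_(a, k) (r a ^_ k)%:R : 'M[R]_j) != 0.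
Proof.
move=> r_inj; rewrite -det_tr; apply/negP => /det0P [v v0 vr].
pose p := \sum_(k < j) v 0 k *: ffact_poly R k.
have pE m : p.[m%:R] = \sum_(k < j) v 0 k * (m ^_ k)%:R.
  rewrite horner_sum; apply: eq_bigr => k _.
  by rewrite hornerZ horner_ffact_poly.
have p_eq0 : p = 0.
  apply: contraNeq v0 => p0; exfalso.
  pose rs : seq R := [seq (r a)%:R | a <- enum 'I_j].
  have : (size rs < size p)%N.
    apply: max_poly_roots => //.
      apply/allP => _ /mapP [a _ ->]; rewrite /root pE.
      move/matrixP/(_ 0 a): vr; rewrite !mxE => vra.
      rewrite -[X in _ == X]vra; apply/eqP.
      by apply: eq_bigr => k _; rewrite !mxE.
    rewrite map_inj_uniq ?enum_uniq // => a b /eqP.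
    by rewrite eqr_nat => /eqP /r_inj.
  rewrite size_map size_enum_ord ltnNge; apply/negP; rewrite negbK.
  apply: (leq_trans (size_sum _ _ _)); apply/bigmax_leqP => k _.
  by apply: leq_trans (size_scale_leq _ _) _; rewrite size_ffact_poly.
apply/negP: v0; rewrite negbK; apply/eqP/rowP => k; rewrite mxE.
have [m] := ubnP (k : nat); elim: m k => // m IHm k; rewrite ltnS => km.
have := pE k; rewrite p_eq0 horner0 (bigD1 k) //=.
rewrite big1 ?addr0 => [/esym/eqP|i ik].
  by rewrite mulf_eq0 ffactnn pnatr_eq0 -leqn0 leqNgt fact_gt0 orbF => /eqP.
have [ki|ik'|/val_inj kE] := ltngtP (k : nat) i; last by rewrite kE eqxx in ik.
  by rewrite ffact_small // mulr0.
by rewrite IHm ?mul0r // (leq_trans ik').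
Qed.

(** Some term of the nonzero determinant of the [r a ^_ k] does not vanish, and
    its permutation of the columns is dominated by [r]. *)
Lemma sum_ord_le_inj (j : nat) (r : 'I_j -> nat) :
  injective r -> (\sum_(k < j) k <= \sum_(a < j) r a)%N.
Proof.
move=> /(@det_ffact_neq0 rat) det0.
have [s sr] : exists s : 'S_j, forall a, (s a <= r a)%N.
  apply: contrapT => nos; case/eqP: det0; apply: big1 => s _.
  have [a sa] : exists a, (r a < s a)%N.
    apply: contrapT => noa; apply: nos; exists s => a; rewrite leqNgt.
    by apply/negP => ra; apply: noa; exists a.
  by rewrite (bigD1 a) //= mxE ffact_small // mul0r mulr0.
rewrite (reindex_perm s) /=; exact: leq_sum.
Qed.

Lemma det_scale (R : comNzRingType) (j : nat) (x y : 'I_j -> R) (A : 'M[R]_j) :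
  \det (\matrix_(a, b) (x a * y b * A a b)) =
  (\prod_a x a) * (\prod_b y b) * \det A.
Proof.
have -> : \matrix_(a, b) (x a * y b * A a b) =
    diag_mx (\row_a x a) *m A *m diag_mx (\row_b y b).
  by apply/matrixP => a b; rewrite mul_mx_diag mul_diag_mx !mxE mulrAC.
rewrite !det_mulmx !det_diag mulrAC; congr (_ * _ * _);
  by apply: eq_bigr => a _; rewrite mxE.
Qed.

Lemma cvg_det (R : realType) (T : Type) (F : set_system T) {FF : Filter F}
    (j : nat) (A : T -> 'M[R]_j) (L : 'M[R]_j) :
  (forall a b, (fun t => A t a b) @ F --> L a b) ->
  (fun t => \det (A t)) @ F --> \det L.
Proof.
move=> AL; rewrite /determinant.
apply: (@cvg_big R _ +%R 0 xpredT (@add_continuous _)) => s _.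
apply: (@cvgM _ _ F _ (fun=> (-1) ^+ s) _ ((-1) ^+ s)); first exact: cvg_cst.
by apply: (@cvg_big R _ *%R 1 xpredT (@mul_continuous _)) => i _; exact: AL.
Qed.

(** The scaling of the entries by row and column powers makes sense for all
    columns [k], also beyond [r] where the entry itself need not vanish; there
    the limit is [0], as is the falling factorial. *)
Lemma tridiagonal_entry (R : realType) (J : set R) (t0 : R)
    (f kap : nat -> R -> R) (r k : nat) :
  is_interval J -> J t0 ->
  tridiagonal_flow J f kap ->
  (forall k, kap k @ within J t0^' --> kap k t0) ->
  (forall i, (i < r)%N -> f i t0 = 0) ->
  (forall i, (i < k)%N -> kap i t0 != 0) ->
  (fun t => (t - t0) ^- r * (t - t0) ^+ k * f k t) @ within J t0^' -->
    (f r t0 * \prod_(0 <= i < r) kap i t0 / r`!%:R)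
    * (\prod_(0 <= i < k) kap i t0)^-1 * (r ^_ k)%:R.
Proof.
move=> iJ Jt0 f_df kap_cvg f0 kap0.
have [kr|rk] := leqP k r; last first.
  have fk := has_derivative_in_continuous (f_df k t0 Jt0).
  have tX := @cvg_expn_base R J t0 (k - r); rewrite subn_gt0 in tX.
  refine (cvg_near_ext _ _ (cvgM (tX rk) fk)); last first.
    by rewrite ffact_small // mulr0 mul0r.
  near=> t.
  have t0N : (t - t0) ^+ r != 0.
    rewrite expf_neq0 //; near: t.
    by apply: filterS (near_within_neq J t0) => s [].
  change ((t - t0) ^+ (k - r) * f k t =
    (t - t0) ^- r * (t - t0) ^+ k * f k t).
  have -> : (t - t0) ^+ k = (t - t0) ^+ (k - r) * (t - t0) ^+ r.
    by rewrite -exprD subnK // ltnW.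
  by rewrite (mulrC _ ((t - t0) ^+ r)) mulrA mulVf ?mul1r.
refine (cvg_near_ext _ _
  (tridiagonal_growth iJ Jt0 f_df kap_cvg f0 (subnKC kr))).
  near=> t; congr (_ * _).
  have t0N : t - t0 != 0.
    by near: t; apply: filterS (near_within_neq J t0) => s [].
  by rewrite -{2}(subnK kr) exprD invfM -mulrA mulVf ?mulr1 // expf_neq0.
rewrite [\prod_(0 <= i < r) _](big_cat_nat (n := k)) //=.
rewrite -(ffact_fact kr) natrM invfM.
have P0 : \prod_(0 <= i < k) kap i t0 != 0.
  rewrite big_mkord; apply/prodf_neq0 => i _; exact/kap0.
have X0 : (r ^_ k)%:R != 0 :> R by rewrite pnatr_eq0 -lt0n ffact_gt0.
have Y0 : (r - k)`!%:R != 0 :> R by rewrite pnatr_eq0 -lt0n fact_gt0.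
by field; rewrite P0 X0 Y0.
Unshelve. all: end_near. Qed.

(** Scaling the rows and columns by powers of [t - t0] makes all entries converge
    and only contributes a power of [t - t0] to the determinant; the limit
    matrix is that of the falling factorials, scaled in turn. *)
Lemma tridiagonal_det_growth (R : realType) (J : set R) (t0 : R) (n j : nat)
    (f : 'I_j -> nat -> R -> R) (kap : nat -> R -> R) (r : 'I_j -> nat) :
  is_interval J -> J t0 ->
  (forall a, tridiagonal_flow J (f a) kap) ->
  (forall k, kap k @ within J t0^' --> kap k t0) ->
  (forall i, (i < n)%N -> kap i t0 != 0) ->
  injective r -> (forall a, r a <= n)%N -> (j <= n.+1)%N ->
  (forall a i, (i < r a)%N -> f a i t0 = 0) ->
  (forall a, f a (r a) t0 != 0) ->
  exists2 l, l != 0 &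
    (fun t => (t - t0) ^- (\sum_a r a - \sum_(k < j) k)
      * \det (\matrix_(a, k < j) f a k t)) @ within J t0^' --> l.
Proof.
move=> iJ Jt0 f_df kap_cvg kap0 r_inj r_le j_le f0 fr0.
have kap0r m i : (m <= n)%N -> (i < m)%N -> kap i t0 != 0.
  by move=> mn im; apply: kap0; exact: leq_trans mn.
have P0 m : (m <= n)%N -> \prod_(0 <= i < m) kap i t0 != 0.
  move=> mn; rewrite big_mkord; apply/prodf_neq0 => i _.
  exact: kap0r mn _.
pose x a := f a (r a) t0 * \prod_(0 <= i < r a) kap i t0 / (r a)`!%:R.
pose y (k : 'I_j) := (\prod_(0 <= i < k) kap i t0)^-1.
have k_le (k : 'I_j) : (k <= n)%N by rewrite -ltnS (leq_trans _ j_le).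
exists (\det (\matrix_(a, k) (x a * y k * (\matrix_(a, k) (r a ^_ k)%:R) a k))).
  rewrite det_scale !mulf_neq0 ?det_ffact_neq0 //; apply/prodf_neq0.
    move=> a _; rewrite /x mulf_neq0 ?mulf_neq0 ?fr0 ?P0 //.
  by move=> k _; rewrite invr_eq0 P0.
have entries a k : (fun t => (\matrix_(a, k < j)
      ((t - t0) ^- r a * (t - t0) ^+ k * (\matrix_(a, k < j) f a k t) a k)) a k)
    @ within J t0^' -->
    (\matrix_(a, k) (x a * y k * (\matrix_(a, k) (r a ^_ k)%:R) a k)) a k.
  under eq_fun do rewrite !mxE; rewrite !mxE.
  apply: (tridiagonal_entry iJ Jt0) => // [i ir|i ik].
  - exact: f0.
  - exact: kap0r (k_le k) ik.
refine (cvg_near_ext _ erefl (cvg_det entries)); near=> t; rewrite det_scale.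
have t0N : t - t0 != 0.
  by near: t; apply: filterS (near_within_neq J t0) => s [].
congr (_ * _); rewrite prodfV !prodrXr -{1}(subnK (sum_ord_le_inj r_inj)).
by rewrite exprD invfM -mulrA mulVf ?mulr1 // expf_neq0.
Unshelve. all: end_near. Qed.

(** * Bruhat decomposition and southwest minors *)

Definition bordered_right (R : nmodType) (N : nat) (i : 'I_N.+1)
    (c : 'I_N.+1 -> R) (X : 'M[R]_N) : 'M[R]_N.+1 :=
  \matrix_(k, l) if unlift i l is Some b then
    if unlift i k is Some a then X a b else 0 else c k.

Definition bordered_top (R : nmodType) (N : nat) (d : 'I_N.+1 -> R)
    (Y : 'M[R]_N) : 'M[R]_N.+1 :=
  \matrix_(k, l) if unlift ord0 k is Some a then
    if unlift ord0 l is Some b then Y a b else 0 else d l.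

(** The shape of one elimination step: a rank one term with pivot row [i] and
    pivot column [ord0], plus a product of the same kind one size smaller. *)
Lemma bordered_mul (R : nzRingType) (N : nat) (i : 'I_N.+1) c d
    (X Y : 'M[R]_N) (s : 'S_N) :
  bordered_right i c X *m perm_mx (lift_perm i ord0 s) *m bordered_top d Y =
  \matrix_(k, l) (c k * d l +
    (if unlift i k is Some a then
      if unlift ord0 l is Some b then (X *m perm_mx s *m Y) a b else 0 else 0)).
Proof.
apply/matrixP => k l; rewrite -mulmxA -row_permE !mxE.
rewrite (bigD1_ord i) //= !mxE unlift_none lift_perm_id unlift_none.
congr (_ + _); rewrite -mulmxA -row_permE.
under eq_bigr do rewrite !mxE liftK lift_perm_lift liftK.
case: (unlift i k) => [a|]; last by rewrite big1 // => b _; rewrite mul0r.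
case: (unlift ord0 l) => [b|]; last by rewrite big1 // => b _; rewrite mulr0.
by rewrite !mxE; apply: eq_bigr => m _; rewrite !mxE.
Qed.

Lemma bordered_top_unit (R : comUnitRingType) (N : nat) d (Y : 'M[R]_N) :
  bordered_top d Y \in unitmx -> Y \in unitmx.
Proof.
rewrite !unitmxE (expand_det_col _ ord0) big_ord_recl big1 ?addr0 => [|k _].
  rewrite unitrM => /andP[_]; rewrite /cofactor expr0 mul1r.
  suff -> : row' ord0 (col' ord0 (bordered_top d Y)) = Y by [].
  by apply/matrixP => a b; rewrite !mxE !liftK.
by rewrite !mxE liftK unlift_none mul0r.
Qed.

(** Elimination: the lowest nonzero entry of the first column is a pivot which
    upper triangular row operations clear upwards and upper triangular column
    operations clear rightwards; the induction continues on the Schur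
    complement. *)
Lemma bruhat_decomposition (R : realType) (N : nat) (M : 'M[R]_N) :
  M \in unitmx -> exists U1 U2 : 'M[R]_N, exists s : 'S_N,
  [/\ upper_triangular U1 /\ U1 \in unitmx, upper_triangular U2 /\ U2 \in unitmx
    & M = U1 *m perm_mx s *m U2].
Proof.
elim: N M => [|N IHN] M uM.
  exists 1%:M, 1%:M, 1%g; split; first by split; [case|exact: unitmx1].
    by split; [case|exact: unitmx1].
  by apply/matrixP => -[].
have [i0 Mi0] : exists i, M i ord0 != 0.
  apply: contrapT => noi; move: uM; rewrite unitmxE unitfE.
  rewrite (expand_det_col _ ord0) big1 ?eqxx // => i _.
  by have [->|Mi] := eqVneq (M i ord0) 0; [rewrite mul0r|case: noi; exists i].
case: (@arg_maxnP _ i0 (fun i => M i ord0 != 0) (fun i => i : nat) Mi0).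
move=> i Mi i_max {i0 Mi0}.
pose c k := M k ord0 / M i ord0; pose d l := M i l.
pose S : 'M[R]_N := \matrix_(a, b)
  (M (lift i a) (lift ord0 b) - c (lift i a) * d (lift ord0 b)).
have ME X (s : 'S_N) Y : S = X *m perm_mx s *m Y ->
    M = bordered_right i c X *m perm_mx (lift_perm i ord0 s)
      *m bordered_top d Y.
  rewrite bordered_mul => <-; apply/matrixP => k l; rewrite mxE.
  case: unliftP => [a ->|->]; last by rewrite addr0 /c divff // mul1r.
  case: unliftP => [b ->|->]; last by rewrite addr0 /c /d divfK.
  by rewrite !mxE addrC subrK.
have uS : S \in unitmx.
  have := uM; rewrite (@ME 1%:M 1%g S) ?perm_mx1 ?mul1mx //.
  by rewrite unitmx_mul => /andP[_ /bordered_top_unit].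
have [U1 [U2 [s [[tU1 uU1] [tU2 uU2] SE]]]] := IHN S uS.
exists (bordered_right i c U1), (bordered_top d U2), (lift_perm i ord0 s).
have ME' := ME _ _ _ SE; have := uM; rewrite {1}ME' !unitmx_mul.
case/andP => /andP[u1 _] u2; split=> //; split=> // k l lk; rewrite mxE.
  case: unliftP lk => [b ->|->] lk.
    case: unliftP lk => [a ->|//]; rewrite /= /bump => lk.
    by apply: tU1; move: lk; do 2 case: leqP; lia.
  rewrite /c; have [->|/i_max] := eqVneq (M k ord0) 0; first by rewrite mul0r.
  by rewrite /= leqNgt lk.
case: unliftP lk => [a ->|->//] lk; case: unliftP lk => [b ->|//] lk.
exact: tU2.
Qed.

Lemma upper_triangular_diag (R : realType) (N : nat) (U : 'M[R]_N) i :
  upper_triangular U -> U \in unitmx -> U i i != 0.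
Proof.
move=> tU; rewrite unitmxE unitfE -det_tr det_trig.
  by move=> /prodf_neq0 /(_ i isT); rewrite mxE.
by apply/is_trig_mxP => a b ab; rewrite mxE tU.
Qed.

Definition bottom_row (n j : nat) (a : 'I_j) : 'I_n.+1 := inord (n.+1 - j + a).

Lemma val_bottom_row (n j : nat) (a : 'I_j) :
  (j <= n.+1)%N -> bottom_row n a = (n.+1 - j + a)%N :> nat.
Proof. by move=> jn; rewrite inordK //; have := ltn_ord a; lia. Qed.

(** Left multiplication by an upper triangular matrix combines each row with
    lower ones only, so it acts on the bottom rows through its own southeast
    block. *)
Lemma southwest_mul (R : realType) (n j : nat) (U M : 'M[R]_n.+1) :
  (j <= n.+1)%N -> upper_triangular U ->
  southwest j (U *m M) =
  (\matrix_(a, b) U (bottom_row n a) (bottom_row n b)) *m southwest j M.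
Proof.
move=> jn tU; apply/matrixP => a b; rewrite !mxE.
pose h k : 'I_j := insubd a (k - (n.+1 - j))%N.
rewrite (bigID (fun l : 'I_n.+1 => (n.+1 - j <= l)%N)) /= [X in _ + X]big1.
  rewrite addr0 (reindex_onto (@bottom_row n j) (fun l => h l)) /=.
    apply: eq_big => [c|c _]; last by rewrite !mxE.
    rewrite val_bottom_row // leq_addr /= -val_eqE /h val_insubd addKn.
    by rewrite ltn_ord eqxx.
  move=> l jl; apply: val_inj; rewrite /= val_bottom_row // /h val_insubd.
  by have := ltn_ord l; case: ifP; lia.
move=> l; rewrite -ltnNge => lj; rewrite tU ?mul0r // -/(bottom_row n a).
by rewrite val_bottom_row //; lia.
Qed.

Lemma det_southwest_mul (R : realType) (n j : nat) (U : 'M[R]_n.+1) :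
  (j <= n.+1)%N -> upper_triangular U -> U \in unitmx ->
  exists2 u, u != 0 & forall M, \det (southwest j (U *m M)) =
    u * \det (southwest j M).
Proof.
move=> jn tU uU.
exists (\det (\matrix_(a, b < j) U (bottom_row n a) (bottom_row n b))).
  rewrite -det_tr det_trig.
    by apply/prodf_neq0 => a _; rewrite !mxE upper_triangular_diag.
  apply/is_trig_mxP => a b ab.
  by rewrite !mxE tU // !val_bottom_row // ltn_add2l.
by move=> M; rewrite southwest_mul // det_mulmx.
Qed.

(** The reversal in [eta_perm] turns the bottom rows into the first indices. *)
Lemma sum_perm_prefix (n j : nat) (s : 'S_n.+1) :
  (j <= n.+1)%N ->
  (\sum_(a < j) (s (rev_ord (bottom_row n a)) : nat)
   = \sum_(i < n.+1 | i < j) s i)%N.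
Proof.
move=> jn; rewrite (reindex_inj rev_ord_inj) /=.
under eq_bigr => a _.
  rewrite (_ : rev_ord (bottom_row n (rev_ord a)) = inord a); first over.
  apply: val_inj; rewrite /= val_bottom_row // inordK /=.
    by have := ltn_ord a; lia.
  by have := ltn_ord a; lia.
rewrite (big_ord_widen _ (fun a => s (inord a) : nat) jn).
by apply: eq_bigr => i _; rewrite inord_val.
Qed.

Lemma mult_permE (n j : nat) (s : 'S_n.+1) :
  (j <= n.+1)%N -> mult_perm s j =
  (\sum_(a < j) (s (rev_ord (bottom_row n a)) : nat) - \sum_(k < j) k)%N.
Proof.
by move=> jn; rewrite sum_perm_prefix // /mult_perm (big_ord_widen _ id jn).
Qed.

Lemma bottom_row_inj (n j : nat) : (j <= n.+1)%N -> injective (@bottom_row n j).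
Proof.
move=> jn a b /(congr1 val); rewrite /= !val_bottom_row // => /addnI.
exact: val_inj.
Qed.

(** Multiplicities give back the prefix sums of the values, since truncated
    subtraction is exact on them, and the whole sum is the same for all
    permutations. *)
Lemma mult_perm_inj (n : nat) (s s' : 'S_n.+1) :
  (forall j, (1 <= j <= n)%N -> mult_perm s j = mult_perm s' j) -> s = s'.
Proof.
move=> eq_mult.
pose T (q : 'S_n.+1) j := (\sum_(i < n.+1 | i < j) q i)%N.
have eq_T j : (j <= n.+1)%N -> T s j = T s' j.
  have full q : T q n.+1 = (\sum_(i < n.+1) i)%N.
    rewrite /T [RHS](reindex_perm q); apply: eq_bigl => i.
    by rewrite ltn_ord.
  case: j => [|j] jn; first by rewrite /T !big_pred0.
  have [->|jn'] := eqVneq j n; first by rewrite !full.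
  have jn1 : (j.+1 <= n)%N by lia.
  have le q : (\sum_(k < j.+1) k <= T q j.+1)%N.
    rewrite /T -sum_perm_prefix //; apply: sum_ord_le_inj => a b.
    by move=> /val_inj /perm_inj /rev_ord_inj /bottom_row_inj ->.
  have := eq_mult j.+1; rewrite jn1 => /(_ isT); rewrite !mult_permE //.
  rewrite !sum_perm_prefix // -/(T s _) -/(T s' _).
  by have := le s; have := le s'; lia.
have T_step q (i : 'I_n.+1) : T q i.+1 = (q i + T q i)%N.
  rewrite /T (bigD1 i) //=; congr (_ + _)%N; apply: eq_bigl => k.
  by rewrite ltnS ltn_neqAle andbC.
apply/permP => i; apply: val_inj => /=.
have := eq_T i.+1 (ltn_ord i); rewrite !T_step eq_T ?(ltnW (ltn_ord i)) //.
by move/addIn.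
Qed.

(** * Conjugation by spin elements *)

Lemma clsign_sq (K : fieldType) (N : nat) (A B : {set 'I_N}) :
  clsign K A B * clsign K A B = 1.
Proof. by rewrite -clsignDl symdiffv clsign0l. Qed.

(** The antiautomorphism that negates the generators. The square of [clbasis A]
    is the sign [clsign A A], so on the basis it is the inversion. *)
Definition clconj (K : fieldType) (N : nat) (x : clifford K N) :
  clifford K N := [ffun A => clsign K A A * clcoef x A].

Lemma clcoef_conj (K : fieldType) (N : nat) (x : clifford K N) A :
  clcoef (clconj x) A = clsign K A A * clcoef x A.
Proof. by rewrite /clcoef ffunE. Qed.

Lemma clcoef_mul (K : fieldType) (N : nat) (x y : clifford K N) C :
  clcoef (x * y) C =
  \sum_A clsign K A (symdiff A C) * clcoef x A * clcoef y (symdiff A C).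
Proof. exact: clcoefM. Qed.

Lemma clcoef0 (K : fieldType) (N : nat) (A : {set 'I_N}) :
  clcoef (0 : clifford K N) A = 0.
Proof. by rewrite /clcoef ffunE. Qed.

Lemma clcoefN (K : fieldType) (N : nat) (x : clifford K N) A :
  clcoef (- x) A = - clcoef x A.
Proof. by rewrite /clcoef ffunE. Qed.

Lemma clcoef_sum (K : fieldType) (N : nat) (I : finType)
    (x : I -> clifford K N) A :
  clcoef (\sum_i x i) A = \sum_i clcoef (x i) A.
Proof.
by elim/big_rec2: _ => [|i a b _ <-]; rewrite ?clcoef0 ?clcoefD.
Qed.

(** The form [A, B |-> clsign A B] is bimultiplicative for the symmetric
    difference, so the diagonal signs differ from a character exactly by the
    commutation signs of the basis: this makes conjugation reverse products. *)
Lemma clconjM (K : fieldType) (N : nat) (x y : clifford K N) :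
  clconj (x * y) = clconj y * clconj x.
Proof.
apply: clifford_eqP => C; rewrite clcoef_conj !clcoef_mul mulr_sumr.
have symdiff_inj : injective (fun A => symdiff A C).
  by move=> A B AB; rewrite -(symdiffK C A) -(symdiffK C B) !(symdiffC C) AB.
rewrite [RHS](reindex_inj symdiff_inj); apply: eq_bigr => A _ /=.
have [B ->] : exists B, C = symdiff A B.
  by exists (symdiff A C); rewrite symdiffK.
rewrite symdiffK (symdiffC A B) symdiffK !clcoef_conj clsignDl !clsignDr.
transitivity (clsign K A B * clsign K A B * (clsign K A A * clsign K B B
   * clsign K B A * clcoef x A * clcoef y B)); first by ring.
by rewrite clsign_sq; ring.
Qed.

Lemma clconj1 (K : fieldType) (N : nat) : clconj (1 : clifford K N) = 1.
Proof.
apply: clifford_eqP => A; rewrite clcoef_conj.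
have -> : (1 : clifford K N) = clbasis K finset.set0 by [].
by rewrite clcoefB; case: eqP => [->|]; rewrite ?clsign0l ?mul1r ?mulr0.
Qed.

(** A condition on each coordinate separately, so that it passes to the
    derivative of a curve. *)
Definition is_clvector (K : fieldType) (N : nat) (x : clifford K N) : Prop :=
  forall A : {set 'I_N}, #|A| != 1%N -> clcoef x A = 0.

Lemma is_clvectorD (K : fieldType) (N : nat) (x y : clifford K N) :
  is_clvector x -> is_clvector y -> is_clvector (x + y).
Proof. by move=> vx vy A nA; rewrite clcoefD vx ?vy ?addr0. Qed.

Lemma is_clvectorZ (K : fieldType) (N : nat) a (x : clifford K N) :
  is_clvector x -> is_clvector (a *: x).
Proof. by move=> vx A nA; rewrite clcoefZ vx ?mulr0. Qed.

Lemma is_clvector_gen (K : fieldType) (N : nat) (i : 'I_N) :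
  is_clvector (clgen K i).
Proof.
by move=> A; rewrite clcoefB; case: (A =P _) => [->|_ _]; rewrite ?cards1.
Qed.

Lemma is_clvector_vec (K : fieldType) (N : nat) (v : 'rV[K]_N) :
  is_clvector (clvec v).
Proof.
move=> A nA; rewrite clcoef_sum big1 // => i _.
by rewrite clcoefZ is_clvector_gen ?mulr0.
Qed.

Lemma clvector_coords (K : fieldType) (N : nat) (x : clifford K N) :
  is_clvector x -> x = clvec (\row_i clcoef x [set i]).
Proof.
move=> vx; apply: clifford_eqP => A.
have [/cards1P [i ->]|nA] := boolP (#|A| == 1%N); last first.
  by rewrite vx ?is_clvector_vec.
rewrite clcoef_sum (bigD1 i) //= big1 ?addr0 => [|k ki].
  by rewrite clcoefZ clcoefB eqxx mulr1 mxE.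
rewrite clcoefZ clcoefB; case: eqP => [/set1_inj ik|]; rewrite ?mulr0 //.
by rewrite ik eqxx in ki.
Qed.

Lemma clconj_vector (K : fieldType) (N : nat) (x : clifford K N) :
  is_clvector x -> clconj x = - x.
Proof.
move=> vx; apply: clifford_eqP => A; rewrite clcoef_conj clcoefN.
have [/cards1P [i ->]|nA] := boolP (#|A| == 1%N); last first.
  by rewrite vx ?mulr0 ?oppr0.
by rewrite /clsign !big_set1 leqnn mulN1r.
Qed.

Lemma clvec_anticomm (K : fieldType) (N : nat) (v w : 'rV[K]_N) :
  clvec v * clvec w + clvec w * clvec v
  = (- (\sum_i v 0 i * w 0 i) *+ 2)%:A.
Proof.
rewrite {2 3}/clvec mulr_suml mulr_sumr -big_split /=.
rewrite /clvec.
transitivity (\sum_(j < N) \sum_(i < N)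
   (v 0 j * w 0 i) *: (clgen K j * clgen K i + clgen K i * clgen K j)).
  apply: eq_bigr => j _; rewrite mulr_suml mulr_sumr -big_split /=.
  apply: eq_bigr => i _; rewrite -!scalerAl -!scalerAr !scalerA.
  by rewrite (mulrC (w 0 i)) -scalerDr.
rewrite -sumrN -sumrMnl scaler_suml; apply: eq_bigr => j _.
rewrite (bigD1 j) //= big1 ?addr0 => [|i ij]; rewrite clgenM scalerA.
  by rewrite eqxx mulrnAr mulrN1.
by rewrite eq_sym (negPf ij) oppr0 mul0rn mulr0 scale0r.
Qed.

(** What is used of a product of unit vectors. It is stable under products, and
    it provides the inverse as a linear function of the coordinates, so that
    differentiating the inverse along a curve is immediate. *)
Definition versor (K : fieldType) (N : nat) (z : clifford K N) : Prop :=
  [/\ clconj z * z = 1, z * clconj z = 1,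
      forall w, is_clvector w -> is_clvector (z * w * clconj z)
    & forall w, is_clvector w -> is_clvector (clconj z * w * z)].

Lemma versor1 (K : fieldType) (N : nat) : versor (1 : clifford K N).
Proof. by split=> [||w|w]; rewrite clconj1 ?mulr1 ?mul1r. Qed.

Lemma versorM (K : fieldType) (N : nat) (x y : clifford K N) :
  versor x -> versor y -> versor (x * y).
Proof.
move=> [x1 x2 x3 x4] [y1 y2 y3 y4]; split=> [||w vw|w vw]; rewrite clconjM.
- by rewrite mulrA -(mulrA (clconj y)) x1 mulr1.
- by rewrite mulrA -(mulrA x) y2 mulr1.
- by move: (x3 _ (y3 _ vw)); rewrite !mulrA.
- by move: (y4 _ (x4 _ vw)); rewrite !mulrA.
Qed.

Lemma lmod_mulr2n_inj (R : realType) (V : lmodType R) (x y : V) :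
  x *+ 2 = y *+ 2 -> x = y.
Proof.
rewrite -(scaler_nat _ x) -(scaler_nat _ y).
move=> /(congr1 (fun x => (2%:R^-1 : R) *: x)).
by rewrite !scalerA mulVf ?scale1r // pnatr_eq0.
Qed.

(** By anticommutation, [v * u * v] is a combination of [u] and [v]: this is the
    reflection of [u] in the hyperplane orthogonal to [v]. *)
Lemma versor_unit_vector (R : realType) (N : nat) (v : 'rV[R]_N) :
  is_unit_vector v -> versor (clvec v).
Proof.
rewrite /is_unit_vector => v1.
have sq : clvec v * clvec v = -1.
  have := clvec_anticomm v v; under eq_bigr do rewrite -expr2.
  by rewrite v1 -mulr2n -scalerMnl scaleN1r => /lmod_mulr2n_inj.
have reflect w : is_clvector w -> is_clvector (- (clvec v * w * clvec v)).
  move=> /clvector_coords ->; set u := \row_i _.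
  have := clvec_anticomm v u; set c := (X in X%:A) => vu.
  have -> : clvec v * clvec u = c%:A - clvec u * clvec v by rewrite -vu addrK.
  rewrite mulrBl -(mulrA (clvec u)) sq mulrN1 opprK opprD -scalerAl mul1r.
  rewrite -scaleNr -(scaleN1r (clvec u)).
  by apply: is_clvectorD; apply: is_clvectorZ; exact: is_clvector_vec.
have vc : clconj (clvec v) = - clvec v by exact/clconj_vector/is_clvector_vec.
split=> [||w /reflect|w /reflect]; rewrite vc.
- by rewrite mulNr sq opprK.
- by rewrite mulrN sq opprK.
- by rewrite mulrN.
- by rewrite !mulNr.
Qed.

Lemma versor_spin (R : realType) (N : nat) (z : clifford R N) :
  spin z -> versor z.
Proof.
case=> s [us _ ->]; elim: s us => [|v s IHs] us.
  by rewrite big_nil; exact: versor1.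
rewrite big_cons; apply: versorM.
  by apply: versor_unit_vector; apply: us; rewrite inE eqxx.
by apply: IHs => w ws; apply: us; rewrite inE ws orbT.
Qed.

Lemma versorV (K : fieldType) (N : nat) (z : clifford K N) :
  versor z -> z^-1 = clconj z.
Proof.
case=> z1 z2 _ _.
have zU : z \is a GRing.unit by apply/unitrP; exists (clconj z).
by rewrite -[LHS]mul1r -z1 mulrK.
Qed.

Lemma versor_cover_unit (R : realType) (N : nat) (z : clifford R N) :
  versor z -> spin_cover z \in unitmx.
Proof.
move=> vz; have [z1 z2 z3 z4] := vz.
pose B := \matrix_(i, j) clcoef (clconj z * clgen R j * z) [set i].
suff /mulmx1_unit [] : spin_cover z *m B = 1%:M by [].
apply/matrixP => i j; rewrite !mxE.
have /(congr1 (fun x => z * x * clconj z)) :=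
  clvector_coords (z4 _ (is_clvector_gen _ j)).
rewrite !mulrA z2 mul1r -mulrA z2 mulr1 /clvec mulr_sumr mulr_suml.
move=> /(congr1 (fun x => clcoef x [set i])).
rewrite clcoefB (inj_eq set1_inj) clcoef_sum => ->; apply: eq_bigr => k _.
by rewrite -scalerAr -scalerAl clcoefZ !mxE versorV // mulrC.
Qed.

(** * The rotation matrix along a curve *)

Lemma curve_derivativeM (R : realType) (N : nat) (J : set R)
    (G H : R -> clifford R N) (t : R) (v w : clifford R N) :
  curve_derivative J G t v -> curve_derivative J H t w ->
  curve_derivative J (fun s => G s * H s) t (v * H t + G t * w).
Proof.
move=> Gv Hw C; rewrite clcoefD !clcoef_mul -big_split /=.
under eq_fun do rewrite clcoef_mul.
apply: has_derivative_in_sum => A.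
have -> : clsign R A (symdiff A C) * clcoef v A * clcoef (H t) (symdiff A C) +
    clsign R A (symdiff A C) * clcoef (G t) A * clcoef w (symdiff A C) =
  clsign R A (symdiff A C) * (clcoef v A * clcoef (H t) (symdiff A C) +
    clcoef (G t) A * clcoef w (symdiff A C)) by ring.
under eq_fun do rewrite -mulrA.
by apply: has_derivative_inZ; exact: has_derivative_inM (Gv A) (Hw _).
Qed.

Lemma curve_derivative_conj (R : realType) (N : nat) (J : set R)
    (G : R -> clifford R N) (t : R) (v : clifford R N) :
  curve_derivative J G t v ->
  curve_derivative J (fun s => clconj (G s)) t (clconj v).
Proof.
move=> Gv A; rewrite clcoef_conj; under eq_fun do rewrite clcoef_conj.
exact: has_derivative_inZ.
Qed.

Lemma curve_derivative_cst (R : realType) (N : nat) (J : set R)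
    (z : clifford R N) (t : R) : curve_derivative J (fun=> z) t 0.
Proof. by move=> A; rewrite clcoef0; exact: has_derivative_in_cst. Qed.

Lemma curve_derivativeMr (R : realType) (N : nat) (J : set R)
    (G : R -> clifford R N) (z : clifford R N) (t : R) (v : clifford R N) :
  curve_derivative J G t v -> curve_derivative J (fun s => G s * z) t (v * z).
Proof.
move=> Gv; have := curve_derivativeM Gv (@curve_derivative_cst R N J z t).
by rewrite mulr0 addr0.
Qed.

Lemma curve_derivativeMl (R : realType) (N : nat) (J : set R)
    (G : R -> clifford R N) (z : clifford R N) (t : R) (v : clifford R N) :
  curve_derivative J G t v -> curve_derivative J (fun s => z * G s) t (z * v).
Proof.
move=> Gv; have := curve_derivativeM (@curve_derivative_cst R N J z t) Gv.
by rewrite mul0r add0r.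
Qed.

(** Differentiating [G t * e_j * (G t)^-1], with the inverse expressed by
    conjugation, gives the conjugate of the bracket of [(G t)^-1 * G' t] and
    [e_j]. The bracket is a vector since the curve stays among vectors, hence
    it is determined by the coordinates that [dspin_cover] records. *)
Lemma spin_cover_derivative (R : realType) (N : nat) (J : set R)
    (G : R -> clifford R N) (t : R) (v : clifford R N) (i j : 'I_N) :
  spin_curve J G -> J t -> ProperFilter (within J t^') ->
  curve_derivative J G t v ->
  has_derivative_in J (fun s => spin_cover (G s) i j) t
    ((spin_cover (G t) *m dspin_cover ((G t)^-1 * v)) i j).
Proof.
move=> spinG Jt PF Gv.
have versorG s : J s -> versor (G s) by move=> /spinG /versor_spin.
have [z1 z2 z3 z4] := versorG t Jt; have tv := versorV (versorG t Jt).
set xi := (G t)^-1 * v.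
have Gxi : v = G t * xi by rewrite /xi tv mulrA z2 mul1r.
have conjv : clconj v = - (xi * clconj (G t)).
  have := curve_derivativeM Gv (curve_derivative_conj Gv).
  set w := (X in curve_derivative _ _ _ X) => Gw.
  have w0 : w = 0.
    apply: clifford_eqP => A; apply: has_derivative_in_unique PF (Gw A) _.
    rewrite clcoef0; refine (has_derivative_in_ext Jt _ erefl
      (@has_derivative_in_cst R J (clcoef 1 A) t)).
    by move=> s /versorG [_ -> _ _].
  have /eqP := congr1 (fun x => clconj (G t) * x) w0.
  rewrite mulr0 /w mulrDr mulrA [X in _ + X]mulrA z1 mul1r addrC addr_eq0.
  by move=> /eqP ->; rewrite /xi tv.
pose X s := G s * clgen R j * clconj (G s).
pose bracket := xi * clgen R j - clgen R j * xi.
have Xder : curve_derivative J X t (G t * bracket * clconj (G t)).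
  have <- : v * clgen R j * clconj (G t) + G t * clgen R j * clconj v =
      G t * bracket * clconj (G t).
    by rewrite conjv {1}Gxi /bracket mulrN mulrBr mulrBl !mulrA.
  apply: curve_derivativeM (curve_derivative_conj Gv).
  exact: curve_derivativeMr Gv.
have bracketE : bracket = \sum_k dspin_cover xi k j *: clgen R k.
  have vX : is_clvector (G t * bracket * clconj (G t)).
    move=> A nA; apply: has_derivative_in_unique PF (Xder A) _.
    refine (has_derivative_in_ext Jt _ erefl (@has_derivative_in_cst R J 0 t)).
    move=> s /versorG [_ _ vG _]; rewrite [RHS](vG _ _ A nA) //.
    exact: is_clvector_gen.
  have := z4 _ vX; rewrite !mulrA z1 mul1r -mulrA z1 mulr1 => vb.
  rewrite {1}(clvector_coords vb) /clvec.
  by apply: eq_bigr => k _; rewrite !mxE.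
have -> : (spin_cover (G t) *m dspin_cover xi) i j =
    clcoef (G t * bracket * clconj (G t)) [set i].
  rewrite bracketE mulr_sumr mulr_suml clcoef_sum mxE; apply: eq_bigr => k _.
  by rewrite -scalerAr -scalerAl clcoefZ mulrC [spin_cover _ _ _]mxE tv.
refine (has_derivative_in_ext Jt _ erefl (Xder [set i]%SET)) => s Js.
by rewrite mxE versorV //; exact: versorG.
Qed.

Lemma amx_sumE (R : realType) (n : nat) (kappa : 'I_n -> R) (j : 'I_n) :
  (\sum_i kappa i *: amx R i) (lift ord0 j) (widen_ord (leqnSn n) j) = kappa j.
Proof.
rewrite summxE (bigD1 j) //= big1 ?addr0 => [|i ij]; rewrite !mxE -!val_eqE /=.
  by rewrite !eqxx /= /bump /= add1n gtn_eqF //= subr0 mulr1.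
rewrite /bump /= !add1n eqSS eq_sym val_eqE (negPf ij) /=.
case: eqP => [jE|]; last by rewrite subr0 mulr0.
by rewrite -jE ltn_eqF // subr0 mulr0.
Qed.

(** Functions on the indices extended by [0] to all natural numbers, so that
    recursions over the columns have no boundary cases. *)
Definition extend0 (R : zmodType) (n : nat) (x : 'I_n -> R) (m : nat) : R :=
  if insub m is Some i then x i else 0.

Lemma extend0_ord (R : zmodType) (n : nat) (x : 'I_n -> R) (i : 'I_n) :
  extend0 x i = x i.
Proof. by rewrite /extend0 valK. Qed.

Lemma extend0_out (R : zmodType) (n : nat) (x : 'I_n -> R) (m : nat) :
  (n <= m)%N -> extend0 x m = 0.
Proof. by move=> nm; rewrite /extend0 insubF // ltnNge nm. Qed.

(** Right multiplication by a combination of the [amx R i] is the operator of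
    [tridiagonal_flow]. *)
Lemma mul_amx_sum (R : realType) (n : nat) (kappa : 'I_n -> R)
    (x : 'I_n.+1 -> R) (k : 'I_n.+1) :
  \sum_l x l * (\sum_i kappa i *: amx R i) l k =
  extend0 kappa k * extend0 x k.+1 -
  (if (k : nat) is k'.+1 then extend0 kappa k' * extend0 x k' else 0).
Proof.
transitivity (\sum_i kappa i * (x (lift ord0 i) * (k == i :> nat)%:R
  - x (widen_ord (leqnSn n) i) * (k == i.+1 :> nat)%:R)).
  under eq_bigr do rewrite summxE mulr_sumr.
  rewrite exchange_big; apply: eq_bigr => i _ /=.
  under eq_bigr do rewrite !mxE mulrCA mulrBr.
  rewrite -mulr_sumr sumrB; congr (_ * (_ - _)).
    rewrite (bigD1 (lift ord0 i)) //= big1 ?addr0 => [|l /negPf ->].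
      by rewrite eqxx.
    by rewrite mulr0.
  rewrite (bigD1 (widen_ord (leqnSn n) i)) //= big1 ?addr0 => [|l /negPf ->].
    by rewrite eqxx -val_eqE.
  by rewrite mulr0.
under eq_bigr do rewrite mulrBr.
rewrite sumrB; congr (_ - _).
  have [kn|nk] := ltnP k n; last first.
    rewrite extend0_out // mul0r big1 // => i _.
    by rewrite gtn_eqF ?mulr0 // (leq_trans (ltn_ord i)).
  rewrite (bigD1 (Ordinal kn)) //= big1 ?addr0 => [|i].
    rewrite eqxx mulr1 -(extend0_ord kappa) -(extend0_ord x).
    by [].
  by rewrite -val_eqE eq_sym /= => /negPf ->; rewrite !mulr0.
case: k => [[|k]] kn /=; first by rewrite big1 // => i _; rewrite !mulr0.
have kn' : (k < n)%N by [].
rewrite (bigD1 (Ordinal kn')) //= big1 ?addr0 => [|i].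
  by rewrite eqxx mulr1 -(extend0_ord kappa) -(extend0_ord x).
by rewrite -val_eqE eq_sym /= eqSS => /negPf ->; rewrite !mulr0.
Qed.

(** * Multiplicities of the minors *)

Lemma smooth_curve_derivatives (R : realType) (N : nat) (J : set R)
    (G : R -> clifford R N) :
  smooth_curve J G -> exists dG ddG : R -> clifford R N, forall t, J t ->
    curve_derivative J G t (dG t) /\ curve_derivative J dG t (ddG t).
Proof.
move=> smoothG; have [D HD] := choice smoothG.
pose dG t : clifford R N := [ffun A => D A 1%N t].
pose ddG t : clifford R N := [ffun A => D A 2%N t].
exists dG, ddG => t Jt; split => A; have [D0 DS] := HD A.
  rewrite {2}/clcoef ffunE.
  by apply: has_derivative_in_ext (DS 0%N t Jt) => // s /D0.
rewrite {2}/clcoef ffunE.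
apply: has_derivative_in_ext (DS 1%N t Jt) => // s _.
by rewrite /clcoef ffunE.
Qed.

Lemma southwest_det_cvg (R : realType) (n : nat) (J : set R)
    (Gamma : R -> clifford R n.+1) (t0 : R) (v : clifford R n.+1) (j : nat) :
  spin_curve J Gamma -> J t0 -> ProperFilter (within J t0^') ->
  curve_derivative J Gamma t0 v ->
  (fun t => \det (southwest j (spin_cover (Gamma t)))) @ within J t0^' -->
    \det (southwest j (spin_cover (Gamma t0))).
Proof.
move=> spinG Jt0 PF Gv; apply: cvg_det => a b.
under eq_fun do rewrite mxE; rewrite mxE.
exact: has_derivative_in_continuous
  (@spin_cover_derivative _ _ _ _ _ _ _ _ spinG Jt0 PF Gv).
Qed.

(** Multiplying by [invmx U1] leads to rows whose values at [t0] are, up to sign,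
    rows of an upper triangular matrix, so that each of them is a tridiagonal
    flow issued from a known leading column. *)
Lemma southwest_det_growth (R : realType) (n : nat) (J : set R)
    (Gamma : R -> clifford R n.+1) (t0 : R) (sigma : 'S_n.+1) (j : nat) :
  is_interval J -> (exists a b, [/\ J a, J b & a < b]) ->
  smooth_curve J Gamma -> locally_convex_curve J Gamma -> J t0 ->
  bruhat_cell (eta_perm n * sigma)%g (Gamma t0) -> (j <= n)%N ->
  exists2 l, l != 0 & (fun t => (t - t0) ^- mult_perm sigma j
    * \det (southwest j (spin_cover (Gamma t)))) @ within J t0^' --> l.
Proof.
move=> iJ nJ /smooth_curve_derivatives [dG [ddG derG]].
move=> [spinG _ [kappa kappaG]] Jt0 [_ [U1 [P [U2]]]].
move=> [[tU1 uU1] [e Pe] [tU2 uU2] QE] jn.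
have jn1 : (j <= n.+1)%N by exact: leqW.
have PF t : J t -> ProperFilter (within J t^') by exact: within_dnbhs_proper.
pose Q t := spin_cover (Gamma t); pose M t := invmx U1 *m Q t.
pose A t := dspin_cover ((Gamma t)^-1 * dG t).
have AE t : J t -> A t = \sum_i kappa i t *: amx R i.
  by move=> Jt; have [_] := kappaG t (dG t) Jt (derG t Jt).1.
pose kap m t := extend0 (fun i => kappa i t) m.
pose f (a : 'I_j) m (t : R) : R := extend0 (M t (bottom_row n a)) m.
have Qder t i k : J t ->
    has_derivative_in J (fun s => Q s i k) t ((Q t *m A t) i k).
  move=> Jt.
  exact: (@spin_cover_derivative _ _ _ _ _ _ _ _ spinG Jt (PF t Jt)
    (derG t Jt).1).
have Mder t i k : J t ->
    has_derivative_in J (fun s => M s i k) t ((M t *m A t) i k).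
  move=> Jt; rewrite /M -mulmxA mxE; under eq_fun do rewrite mxE.
  by apply: has_derivative_in_sum => l; apply: has_derivative_inZ; exact: Qder.
have fder a : tridiagonal_flow J (f a) kap.
  move=> k t Jt; have [kn|nk] := leqP k n; last first.
    have -> : f a k = fun=> 0.
      by apply/funext => s; rewrite /f extend0_out.
    rewrite /f extend0_out ?(leqW nk) // mulr0 sub0r.
    case: k nk => // k nk; rewrite /kap extend0_out // mul0r oppr0.
    exact: has_derivative_in_cst.
  have kn1 : (k < n.+1)%N by [].
  have := Mder t (bottom_row n a) (Ordinal kn1) Jt.
  rewrite mxE AE // mul_amx_sum /=.
  by apply: has_derivative_in_ext => // s _; rewrite /f -(extend0_ord (M s _)).
(* [kappa] is only given pointwise; its continuity comes from the entries of
   [A], which are differentiable since [Gamma] is twice differentiable. *)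
have kap_cvg k : kap k @ within J t0^' --> kap k t0.
  have [kn|nk] := ltnP k n; last first.
    have -> : kap k = fun=> 0.
      by apply/funext => s; rewrite /kap extend0_out.
    exact: cvg_cst.
  pose i := Ordinal kn.
  pose k0 := lift ord0 i; pose k1 := widen_ord (leqnSn n) i.
  have kapE t : J t -> kap k t = A t k0 k1.
    by move=> Jt; rewrite AE // amx_sumE /kap (extend0_ord _ i).
  have versor0 s : J s -> (Gamma s)^-1 = clconj (Gamma s).
    by move=> /spinG /versor_spin /versorV.
  have [G1 G2] := derG t0 Jt0.
  have X1 := curve_derivativeM (curve_derivative_conj G1) G2.
  have X2 := curve_derivativeMr (z := clgen R k1) X1.
  have X3 := curve_derivativeMl (z := clgen R k1) X1.
  have := has_derivative_in_continuous (has_derivative_inD (X2 [set k0]%SET)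
    (has_derivative_inZ (c := -1) (X3 [set k0]%SET))).
  have kapX t : J t -> clcoef (clconj (Gamma t) * dG t * clgen R k1) [set k0] +
    -1 * clcoef (clgen R k1 * (clconj (Gamma t) * dG t)) [set k0] = kap k t.
    by move=> Jt; rewrite kapE // mxE -versor0 // clcoefD clcoefN mulN1r.
  move=> H; refine (cvg_near_ext _ (kapX t0 Jt0) H).
  by apply: filterS (near_within_neq J t0) => s [Js _]; exact: kapX.
(* [eta] reverses the indices, so the bottom rows of [P] follow the first
   values of [sigma], in reverse order. *)
pose r (a : 'I_j) : nat := sigma (rev_ord (bottom_row n a)).
have rE a : ((eta_perm n * sigma)%g (bottom_row n a) : nat) = r a.
  by rewrite permM permE.
have r_inj : injective r.
  by move=> a b /val_inj /perm_inj /rev_ord_inj /bottom_row_inj; exact.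
have M0 i k : M t0 i k = (-1) ^+ e i * U2 ((eta_perm n * sigma)%g i) k.
  rewrite /M /Q QE -mulmxA mulKmx // mxE.
  rewrite (bigD1 ((eta_perm n * sigma)%g i)) //= big1 ?addr0 => [|l /negPf li].
    by rewrite Pe eqxx mulr1.
  by rewrite Pe li mulr0 mul0r.
have f0 a i : (i < r a)%N -> f a i t0 = 0.
  move=> ir; have in1 : (i < n.+1)%N by apply: ltn_trans ir (ltn_ord _).
  by rewrite /f (extend0_ord _ (Ordinal in1)) M0 tU2 ?mulr0 // rE.
have fr0 a : f a (r a) t0 != 0.
  rewrite /f -rE extend0_ord M0 mulf_neq0 ?signr_eq0 //.
  exact: upper_triangular_diag.
have kap0 i : (i < n)%N -> kap i t0 != 0.
  move=> lin; rewrite /kap (extend0_ord _ (Ordinal lin)) gt_eqF //.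
  by have [+ _] := kappaG t0 (dG t0) Jt0 (derG t0 Jt0).1; exact.
have r_le a : (r a <= n)%N by rewrite -ltnS ltn_ord.
have [l l0 lim] :=
  tridiagonal_det_growth iJ Jt0 fder kap_cvg kap0 r_inj r_le jn1 f0 fr0.
have [u u0 uE] := det_southwest_mul jn1 tU1 uU1.
exists (u * l); first by rewrite mulf_neq0.
refine (cvg_near_ext _ erefl (cvgM (cvg_cst u) lim)); apply: nearW => t.
have -> : \det (southwest j (spin_cover (Gamma t))) =
    u * \det (southwest j (M t)) by rewrite -uE mulKVmx.
rewrite mult_permE // mulrCA; congr (_ * (_ * _)); congr (\det _).
apply/matrixP => a b; rewrite [LHS]mxE [RHS]mxE /f.
have bn : (b < n.+1)%N by apply: leq_trans jn1.
rewrite (extend0_ord _ (Ordinal bn)) //; congr (M t _ _).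
by apply: val_inj; rewrite /= inordK.
Qed.

(** For multiplicity [0] the definition looks at the value at [t0], which
    continuity identifies with the limit. *)
Lemma zero_of_multiplicityP (R : realType) (J : set R) (m : R -> R) (t0 : R)
    (mu : nat) : ProperFilter (within J t0^') ->
  m @ within J t0^' --> m t0 ->
  zero_of_multiplicity J m t0 mu <->
  (exists2 l, l != 0 & (fun t => (t - t0) ^- mu * m t) @ within J t0^' --> l).
Proof.
move=> PF mc; case: mu => [|mu]; last by [].
have -> : (fun t => (t - t0) ^- 0 * m t) = m.
  by apply/funext => t; rewrite expr0 invr1 mul1r.
split=> [m0|[l l0 ml]]; first by exists (m t0).
by rewrite /= (cvg_unique (@Rhausdorff R) mc ml).
Qed.

Lemma multiplicity_le (R : realType) (J : set R) (m : R -> R) (t0 l l' : R)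
    (mu mu' : nat) : ProperFilter (within J t0^') -> l != 0 ->
  (fun t => (t - t0) ^- mu * m t) @ within J t0^' --> l ->
  (fun t => (t - t0) ^- mu' * m t) @ within J t0^' --> l' ->
  (mu' <= mu)%N.
Proof.
move=> PF l0 lim lim'; rewrite leqNgt; apply/negP => mumu'.
case/eqP: l0; apply: (cvg_unique (@Rhausdorff R) lim).
have tX := @cvg_expn_base R J t0 (mu' - mu); rewrite subn_gt0 in tX.
refine (cvg_near_ext _ _ (cvgM (tX mumu') lim')); last by rewrite mul0r.
near=> t.
have t0N : t - t0 != 0.
  by near: t; apply: filterS (near_within_neq J t0) => s [].
change ((t - t0) ^+ (mu' - mu) * ((t - t0) ^- mu' * m t) =
  (t - t0) ^- mu * m t).
rewrite mulrA; congr (_ * _); rewrite -{2}(subnK (ltnW mumu')) exprD invfM.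
by rewrite mulrA mulfV ?mul1r // expf_neq0.
Unshelve. all: end_near. Qed.

Lemma spin_bruhat_cell (R : realType) (n : nat) (z : clifford R n.+1) :
  spin z -> exists s : 'S_n.+1, bruhat_cell s z.
Proof.
move=> sz; have := versor_cover_unit (versor_spin sz).
move=> /bruhat_decomposition [U1 [U2 [s [tU1 tU2 zE]]]].
exists s; split=> //; exists U1, (perm_mx s), U2; split=> //.
by exists (fun=> false) => i j; rewrite expr0 mul1r !mxE eq_sym.
Qed.

Theorem theorem4 (R : realType) (n : nat) (hn : (2 <= n)%N)
  (J : set R) (hJ : is_interval J)
  (hJ' : exists a b, [/\ J a, J b & a < b])
  (Gamma : R -> clifford R n.+1)
  (hsmooth : smooth_curve J Gamma) (hconvex : locally_convex_curve J Gamma)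
  (t0 : R) (ht0 : J t0) (sigma : 'S_n.+1) :
  bruhat_cell (eta_perm n * sigma)%g (Gamma t0) <->
  (forall j : nat, (1 <= j <= n)%N ->
     zero_of_multiplicity J
       (fun t => \det (southwest j (spin_cover (Gamma t)))) t0 (mult_perm sigma j)).
Proof.
have PF := within_dnbhs_proper hJ hJ' ht0.
have [spinG _ _] := hconvex.
have zeroP j mu : zero_of_multiplicity J
    (fun t => \det (southwest j (spin_cover (Gamma t)))) t0 mu <->
  exists2 l, l != 0 & (fun t => (t - t0) ^- mu *
    \det (southwest j (spin_cover (Gamma t)))) @ within J t0^' --> l.
  apply: zero_of_multiplicityP.
  have [dG [ddG derG]] := smooth_curve_derivatives hsmooth.
  exact: southwest_det_cvg spinG ht0 PF (derG t0 ht0).1.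
split=> [cell j /andP[_ jn]|mults].
  by apply/zeroP; exact: southwest_det_growth cell jn.
have [s cell] := spin_bruhat_cell (spinG t0 ht0).
pose tau := ((eta_perm n)^-1 * s)%g.
have sE : s = (eta_perm n * tau)%g by rewrite mulKVg.
rewrite sE in cell; suff -> : sigma = tau by [].
apply: mult_perm_inj => j j1n; have /zeroP [l l0 lim] := mults j j1n.
have [_ jn] := andP j1n.
have [l' l0' lim'] := southwest_det_growth hJ hJ' hsmooth hconvex ht0 cell jn.
apply/eqP; rewrite eqn_leq.
by rewrite (multiplicity_le PF l0' lim' lim) (multiplicity_le PF l0 lim lim').
Qed.
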